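(* The category $\mathbf{proTorPAb}$ of topological torsion Polish abelian groups has enough injectives and homological dimension $1$.
   Context: A Polish abelian group is an abelian topological group whose topology is Polish. A Polish abelian group is topological torsion if it is isomorphic to the inverse limit of an inverse sequence of countable (discrete) torsion abelian groups. $\mathbf{proTorPAb}$ is the category of topological torsion Polish abelian groups and continuous homomorphisms; it is quasi-abelian. Short exact sequences are the sequences $0\to A\to B\to C\to 0$ of continuous homomorphisms that are algebraically exact with $A\to B$ a homeomorphism onto a closed subgroup. An object $I$ is injective if $\mathrm{Hom}(-,I)$ maps short exact sequences to short exact sequences of abelian groups; the category has enough injectives if every object admits an injective continuous homomorphism with closed image into an injective object. For an exact category $\mathcal{A}$, $\mathrm{Ext}^{n}(A,B):=\mathrm{Hom}_{\mathrm{D}(\mathcal{A})}(A,B[n])$ with $\mathrm{D}(\mathcal{A})$ the derived category (equivalently, Yoneda $n$-extensions for $n\ge 1$), and the homological dimension is the least $d$ such that $\mathrm{Ext}^{n}=0$ for all $n>d$. *)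

(* Defs.v *)
From HB Require Import structures.
From mathcomp Require Import all_boot all_order all_algebra.
From mathcomp Require Import all_classical all_reals topology tvs.
From Stdlib Require Import Relation_Operators.

Set Implicit Arguments.
Unset Strict Implicit.
Unset Printing Implicit Defensive.

Import GRing.Theory.

Local Open Scope classical_set_scope.
Local Open Scope ring_scope.

Definition homeomorphism (S T : topologicalType) (f : S -> T) :=
  continuous f /\
  exists g : T -> S, [/\ continuous g, cancel f g & cancel g f].

Definition separable (T : topologicalType) :=
  exists2 D : set T, countable D & dense D.

(* Completeness is that of the library's complete uniform spaces, stated without
   requiring a distinguished point. *)
Definition complete_metric (R : realType) (M : metricType R) :=
  forall F : set_system M, ProperFilter F -> cauchy F -> exists x : M, F --> x.

Definition polish (R : realType) (T : topologicalType) :=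
  separable T /\
  exists (M : metricType R) (h : T -> M), complete_metric M /\ homeomorphism h.

Definition torsion (A : zmodType) :=
  forall x : A, exists2 m : nat, (0 < m)%N & x *+ m = 0.

(* The inverse limit of discrete groups; as a type, it carries the topology
   induced by the product of the discrete topologies. *)
Definition inverse_limit (A : nat -> zmodType)
    (p : forall n, {additive A n.+1 -> A n}) :
    set (prod_topology (fun n => discrete_topology (A n))) :=
  [set x | forall n, p n (x n.+1) = x n].

(* The group operation of the inverse limit is coordinatewise. *)
Definition topological_torsion (G : topologicalZmodType) :=
  exists (A : nat -> zmodType) (p : forall n, {additive A n.+1 -> A n}),
    (forall n, countable [set: A n] /\ torsion (A n)) /\
    exists f : G -> inverse_limit p,
      homeomorphism f /\
      forall (x y : G) (n : nat),
        set_val (f (x + y)) n = (set_val (f x) n : A n) + set_val (f y) n.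

Record proTorPAb (R : realType) := ProTorPAb {
  carrier :> topologicalZmodType;
  carrier_polish : polish R carrier;
  carrier_topological_torsion : topological_torsion carrier
}.

Record hom (R : realType) (A B : proTorPAb R) := Hom {
  hom_fun :> {additive A -> B};
  hom_continuous : continuous hom_fun
}.

Lemma id_continuous (T : topologicalType) : continuous (idfun : T -> T).
Proof. by move=> x U. Qed.

Definition id_hom (R : realType) (A : proTorPAb R) : hom A A :=
  @Hom R A A idfun (@id_continuous A).

Section ProTorPAbTheory.
Variable R : realType.
Implicit Types A B C I : proTorPAb R.

Definition closed_embedding A B (i : hom A B) :=
  [/\ injective i,
      closed (range i) &
      forall U : set A, open U ->
        exists2 V : set B, open V & i @` U = V `&` range i].

Definition short_exact A B C (i : hom A B) (p : hom B C) :=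
  [/\ closed_embedding i,
      range i = [set y | p y = 0] &
      range p = setT].

(* The three clauses are the exactness of
   0 -> Hom(C, I) -> Hom(B, I) -> Hom(A, I) -> 0 at its three terms. *)
Definition injective_object I :=
  forall A B C (i : hom A B) (p : hom B C), short_exact i p ->
  [/\ forall f g : hom C I, f \o p =1 g \o p -> f =1 g,
      forall f : hom B I,
        (forall x, f (i x) = 0) <-> exists g : hom C I, f =1 g \o p &
      forall f : hom A I, exists g : hom B I, f =1 g \o i].

Definition enough_injectives :=
  forall A, exists (I : proTorPAb R) (j : hom A I),
    [/\ injective_object I, injective j & closed (range j)].

Record ses B A := Ses {
  ses_mid : proTorPAb R;
  ses_inj : hom B ses_mid;
  ses_proj : hom ses_mid A;
  ses_exact : short_exact ses_inj ses_proj
}.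

Definition ses_morphism B A B' A' (b : hom B B') (a : hom A A')
    (E : ses B A) (E' : ses B' A') :=
  exists e : hom (ses_mid E) (ses_mid E'),
    e \o ses_inj E =1 ses_inj E' \o b /\ a \o ses_proj E =1 ses_proj E' \o e.

Record splice (T : proTorPAb R -> Type) A := Splice {
  splice_ker : proTorPAb R;
  splice_ses : ses splice_ker A;
  splice_tail : T splice_ker
}.

(* [yext n A B] is the type of Yoneda [n]-extensions
   0 -> B -> E_n -> ... -> E_1 -> A -> 0, given with the factorization of the
   exact sequence into short exact sequences: for n >= 2 a short exact sequence
   0 -> K -> E_1 -> A -> 0 and an (n-1)-extension of K by B.
   For n = 0 it is Hom(A, B). *)
Fixpoint yext (n : nat) A B : Type :=
  match n with
  | 0 => hom A B
  | m.+1 => match m with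
            | 0 => ses B A
            | _ => splice (fun K => yext m K B) A
            end
  end.

Fixpoint yext_morphism (n : nat) A A' B B' (a : hom A A') (b : hom B B') :
    yext n A B -> yext n A' B' -> Prop :=
  match n with
  | 0 => fun f f' : hom _ _ => b \o f =1 f' \o a
  | m.+1 =>
    match m return (forall K K', hom K K' -> yext m K B -> yext m K' B' -> Prop)
        -> yext m.+1 A B -> yext m.+1 A' B' -> Prop with
    | 0 => fun _ => ses_morphism b a
    | _ => fun rec X X' =>
        exists k : hom (splice_ker X) (splice_ker X'),
          ses_morphism k a (splice_ses X) (splice_ses X') /\
          rec _ _ k (splice_tail X) (splice_tail X')
    end (fun K K' k => @yext_morphism m K K' B B' k b)
  end.

Definition yoneda_equiv n A B : yext n A B -> yext n A B -> Prop :=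
  clos_refl_sym_trans _ (@yext_morphism n A A B B (id_hom A) (id_hom B)).

(* Ext^n(A, B) is the group of classes of [yext n A B] modulo [yoneda_equiv];
   it always contains the class 0, so that it is trivial iff any two elements of
   [yext n A B] are equivalent. *)
Definition Ext_trivial n A B := forall E E' : yext n A B, yoneda_equiv E E'.

Definition Ext_trivial_above (d : nat) :=
  forall n, (d < n)%N -> forall A B, Ext_trivial n A B.

Definition homological_dimension (d : nat) :=
  Ext_trivial_above d /\ forall d', Ext_trivial_above d' -> (d <= d')%N.

End ProTorPAbTheory.

(* Main.v *)
Require Import Defs.
From mathcomp Require Import all_boot all_order all_algebra.
From mathcomp Require Import all_classical all_reals.
From HB Require Import structures.
From mathcomp Require Import ring_quotient generic_quotient topology tvs.
From Stdlib Require Import Relation_Operators.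

(* The topology of an object is given by a complete decreasing sequence of open
   subgroups with countable torsion quotients, and every question becomes one
   about such filtrations.

   A countable product of discrete countable divisible torsion groups is
   injective: a continuous map from a closed subgroup of [B] to a discrete group
   [D] factors through a subgroup of a discrete quotient of [B], and extends if
   [D] is divisible. Every object [A] embeds into such a product [I], and the
   quotient of [I] by [A] has a filtration with divisible graded pieces, hence
   is again such a product. So [A] has an injective resolution of length one,
   whence [Ext^n = 0] for [n > 1]. Finally [Z/2 -> Z/4 -> Z/2] does not split,
   so [Ext^1] is not zero.

   That morphisms out of [B] vanishing on [A] descend to [C], for a short exact
   sequence [A -> B -> C], is the open mapping theorem for [B -> C]. *)

Set Implicit Arguments.
Unset Strict Implicit.
Unset Printing Implicit Defensive.

Import Order.TTheory GRing.Theory Num.Theory.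
(* [hom] is also a notion of the vector library. *)
Import Defs.

Local Open Scope classical_set_scope.
Local Open Scope ring_scope.

(** * Abelian groups *)

Lemma exists_additive (U V : zmodType) (f : U -> V) :
  {morph f : x y / x - y} -> exists g : {additive U -> V}, g =1 f.
Proof.
move=> fB; pose m := GRing.isZmodMorphism.Build U V f fB.
by exists (HB.pack f m : {additive U -> V}).
Qed.

Lemma subrACA (V : zmodType) (a b c d : V) :
  a - b - (c - d) = a - c - (b - d).
Proof. by rewrite !opprD !opprK addrACA. Qed.

Lemma dependent_choice_nat (T : Type) (P : nat -> T -> Prop)
    (Q : nat -> T -> T -> Prop) :
  (exists x, P 0%N x) ->
  (forall n x, P n x -> exists y, P n.+1 y /\ Q n x y) ->
  exists f : nat -> T, forall n, P n (f n) /\ Q n (f n) (f n.+1).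
Proof.
move=> /cid[x0 Px0] step.
have stepT n (x : {x | P n x}) : {y : {y | P n.+1 y} | Q n (sval x) (sval y)}.
  by case: x => x Px; have [y [Py Qy]] := cid (step _ _ Px);
    exists (exist _ y Py).
pose f := fix f n : {x | P n x} :=
  match n with 0 => exist _ x0 Px0 | m.+1 => sval (stepT m (f m)) end.
exists (fun n => sval (f n)) => n; split; first exact: (svalP (f n)).
exact: (svalP (stepT n (f n))).
Qed.

Definition subgroup (G : zmodType) (K : set G) :=
  K 0 /\ forall x y, K x -> K y -> K (x - y).

Section Subgroup.
Variables (G : zmodType) (K : set G).
Hypothesis subK : subgroup K.

Lemma subgroup0 : K 0. Proof. by case: subK. Qed.
Lemma subgroupB x y : K x -> K y -> K (x - y).
Proof. by case: subK => _; exact. Qed.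
Lemma subgroupN x : K x -> K (- x).
Proof.
by move=> Kx; rewrite -sub0r; apply: subgroupB => //; exact: subgroup0.
Qed.
Lemma subgroupD x y : K x -> K y -> K (x + y).
Proof.
by move=> Kx Ky; rewrite -[y]opprK; apply: subgroupB => //;
  exact: subgroupN.
Qed.
Lemma subgroupMn x n : K x -> K (x *+ n).
Proof.
move=> Kx; elim: n => [|n IHn]; first by rewrite mulr0n; exact: subgroup0.
by rewrite mulrS; exact: subgroupD.
Qed.
Lemma subgroupMz x (k : int) : K x -> K (x *~ k).
Proof.
case: k => n Kx; first exact: subgroupMn.
by rewrite NegzE mulrNz; exact/subgroupN/subgroupMn.
Qed.
Lemma subgroupC x y : K (x - y) -> K (y - x).
Proof. by rewrite -(opprB x y); exact: subgroupN. Qed.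
Lemma subgroup_trans y x z : K (x - y) -> K (y - z) -> K (x - z).
Proof. by move=> ? ?; rewrite -(subrKA y); exact: subgroupD. Qed.

End Subgroup.

Lemma subgroup_ker (U V : zmodType) (f : {additive U -> V}) :
  subgroup [set x | f x = 0].
Proof.
by split=> [|x y /= fx fy] /=; rewrite ?raddf0 // raddfB fx fy subr0.
Qed.

Lemma subgroup_image (U V : zmodType) (f : {additive U -> V}) (K : set U) :
  subgroup K -> subgroup (f @` K).
Proof.
move=> subK; split; first by exists 0; [exact: subgroup0|rewrite raddf0].
move=> _ _ [x Kx <-] [y Ky <-]; exists (x - y); last by rewrite raddfB.
exact: subgroupB.
Qed.

Lemma quotient_exists (G : zmodType) (K : set G) : subgroup K ->
  exists (Q : zmodType) (q : {additive G -> Q}),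
    range q = setT /\ forall x, q x = 0 <-> K x.
Proof.
move=> subK; pose P : G -> bool := fun x => `[< K x >].
have PP : zmod_closed P.
  split=> [|x y]; first by apply/asboolP; exact: subgroup0.
  by move=> /asboolP Kx /asboolP Ky; apply/asboolP; exact: subgroupB.
pose S : zmodClosed G := HB.pack P (GRing.isZmodClosed.Build G P PP).
pose Q : zmodType := Quotient.quot S.
have [q qE] : exists q : {additive G -> Q}, q =1 (\pi_(Quotient.quot S))%qT.
  by apply: exists_additive => x y; rewrite raddfB.
exists Q, q; split.
  by apply/seteqP; split=> // y _; exists (repr y); rewrite // qE reprK.
move=> x; rewrite qE; split=> [qx0|Kx].
  have : (x - 0) \in S.
    by rewrite Quotient.idealrBE; apply/eqP; rewrite qx0 raddf0.
  by rewrite subr0 => /asboolP.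
have : (x - 0) \in S by rewrite subr0; apply/asboolP.
by rewrite Quotient.idealrBE => /eqP ->; rewrite raddf0.
Qed.

Definition divisible (D : zmodType) :=
  forall m (d : D), (0 < m)%N -> exists d', d' *+ m = d.

(** * Extension of homomorphisms into divisible groups *)

Section Extension.
Variables (A X D : zmodType) (u : {additive A -> X}) (v : {additive A -> D}).
Hypothesis divD : divisible D.
Hypothesis uv : forall a, u a = 0 -> v a = 0.

(** A homomorphism from a subgroup of [X] to [D], encoded by its graph; for a subgroup of [X * D],
    the second clause amounts to single-valuedness. *)
Let partial_extension (E : set (X * D)) :=
  [/\ subgroup E, forall d, E (0, d) -> d = 0 & forall a, E (u a, v a)].

(** The multiples of [x] in the domain of [E] are those of a least positive one [x *+ m], if there
    is any; an [m]-th part of the value there is then a consistent value at [x]. *)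
Let extension_value E x : partial_extension E ->
  exists d, forall k e, E (x *~ k, e) -> e = d *~ k.
Proof.
move=> [subE E0 _].
have Efun y d1 d2 : E (y, d1) -> E (y, d2) -> d1 = d2.
  move=> E1 E2; apply/eqP; rewrite -subr_eq0; apply/eqP/E0.
  by rewrite -(subrr y); exact: (subgroupB subE E1 E2).
pose dom m := (0 < m)%N && `[< exists d, E (x *+ m, d) >].
have [exm|noex] := pselect (exists m, dom m); last first.
  (* No positive multiple of [x] is in the domain, hence no negative one either, and only [k = 0]
     remains. *)
  exists 0 => k e Exe; rewrite mul0rz; case: (intP k) Exe => [|n|n] Exe.
  - by apply: E0; rewrite mulr0z in Exe.
  - by case: noex; exists n.+1; apply/andP; split=> //; apply/asboolP; exists e.
  case: noex; exists n.+1; apply/andP; split=> //; apply/asboolP; exists (- e).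
  by have := subgroupN subE Exe; rewrite /= -[- (_, _)]/(_, _) mulrNz opprK.
case: (ex_minnP exm) => m /andP[m0 /asboolP[d0 Ed0]] minm.
have [d dm] := divD d0 m0; exists d => k e Exe.
(* The remainder of [k] modulo [m] also gives a multiple in the domain, so it is 0 by minimality of
   [m]. *)
have Ediff : E (x *~ (k %% m)%Z, e - d0 *~ (k %/ m)%Z).
  have := subgroupB subE Exe (subgroupMz subE (k %/ m)%Z Ed0).
  have -> : (x *+ m, d0) *~ (k %/ m)%Z = (x *+ m *~ (k %/ m)%Z, d0 *~ (k %/
    m)%Z).
    by rewrite [LHS]surjective_pairing (raddfMz fst) (raddfMz snd).
  rewrite -[(_, _) - (_, _)]/(_ - _, _ - _).
  rewrite {1}(divz_eq k m) mulrzDr [_ * _%:Z]mulrC mulrzA -pmulrn.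
  by rewrite addrC addKr.
have r0 : (k %% m)%Z = 0.
  have : (0 <= (k %% m)%Z < m)%R by rewrite modz_ge0 ?ltz_mod // gt_eqF.
  case: (k %% m)%Z Ediff => // r Er /andP[_]; rewrite ltz_nat => rm.
  case: r => // r in Er rm *.
  suff /minm : dom r.+1 by rewrite leqNgt rm.
  apply/andP; split=> //; apply/asboolP.
  by exists (e - d0 *~ (k %/ m)%Z).
move: Ediff; rewrite r0 mulr0z => /E0/eqP; rewrite subr_eq0 => /eqP ->.
by rewrite {2}(divz_eq k m) r0 addr0 -dm mulrC mulrzA -pmulrn.
Qed.

Let extend_by_one (E : set (X * D)) x : partial_extension E ->
  exists2 E', partial_extension E' & E `<=` E' /\ exists d, E' (x, d).
Proof.
move=> pE; have [d dE] := extension_value x pE; have [subE E0 Euv] := pE.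
exists [set p | exists k a b, E (a, b) /\ p = (x *~ k + a, d *~ k + b)].
  split=> [|e /= [k [a [b [Eab [xa ->]]]]]|a].
  - split; first by exists 0, 0, 0; rewrite !mulr0z !addr0; split=> //;
      exact: (subgroup0 subE).
    move=> _ _ [k [a [b [Eab ->]]]] [l [a' [b' [Eab' ->]]]].
    exists (k - l), (a - a'), (b - b'); split;
      first exact: (subgroupB subE Eab Eab').
    by rewrite !mulrzBr; congr pair => /=; rewrite opprD addrACA.
  - have := subgroupN subE Eab; rewrite -[- (a, b)]/(- a, - b).
    by move: xa => /esym/eqP; rewrite addr_eq0 => /eqP <- /dE <-; rewrite addNr.
  - by exists 0, (u a), (v a); rewrite !mulr0z !add0r.
split; last by exists d, 1, 0, 0; rewrite !mulr1z !addr0; split=> //;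
  exact: (subgroup0 subE).
by move=> [a b] Eab; exists 0, a, b; rewrite !mulr0z !add0r.
Qed.

(** Baer's argument: a maximal partial extension is defined everywhere, since [extend_by_one] can
    adjoin any [x]. The map [u] may have a kernel, as long as [v] vanishes on it. *)
Lemma divisible_extension : exists w : {additive X -> D}, forall a, w (u a) = v
  a.
Proof.
pose base := [set (u a, v a) | a in [set: A]].
have pbase : partial_extension base.
  split.
  - split; first by exists 0 => //; rewrite !raddf0.
    by move=> _ _ [a _ <-] [b _ <-]; exists (a - b) => //; rewrite !raddfB.
  - by move=> d [a _ [ua <-]]; exact: uv.
  - by move=> a; exists a.
have [F Fsub Ftot|E [pE maxE]] :=
    @Zorn_bigcup (X * D)%type [set E | E = set0 \/ partial_extension E].
  have [[E [FE nE]]|noE] := pselect (exists E, F E /\ E !=set0); last first.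
    left; apply/seteqP; split=> // p [E FE Ep]; case: noE; exists E; split=> //.
    by exists p.
  have Fp E' : F E' -> E' !=set0 -> partial_extension E'.
    by move=> /Fsub [-> [] //|].
  right; split.
  - split; first by exists E => //; have [/subgroup0] := Fp _ FE nE.
    move=> x y [E1 F1 x1] [E2 F2 y2].
    have [[subE1 _ _] [subE2 _ _]] := (Fp _ F1 (ex_intro _ _ x1), Fp _ F2
      (ex_intro _ _ y2)).
    have [E12|E21] := Ftot _ _ F1 F2.
      by exists E2 => //; apply: (subgroupB subE2) => //; exact: E12.
    by exists E1 => //; apply: (subgroupB subE1) => //; exact: E21.
  - by move=> d [E1 F1 E1d]; have [_ + _] := Fp _ F1 (ex_intro _ _ E1d); apply.
  - by move=> a; exists E => //; have [_ _] := Fp _ FE nE.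
have {}pE : partial_extension E.
  case: pE => // E0; case: (maxE base); last by right.
  by rewrite E0; split=> //; move=> /(_ (u 0, v 0)); apply; exists 0.
have domE x : exists d, E (x, d).
  have [E' pE' [EE' [d E'd]]] := extend_by_one x pE; exists d.
  by apply: contrapT => nE; apply: (maxE E'); [split=> // /(_ _ E'd)|right].
have [w wE] := choice domE; have [subE E0 Euv] := pE.
have Efun y d1 d2 : E (y, d1) -> E (y, d2) -> d1 = d2.
  move=> E1 E2; apply/eqP; rewrite -subr_eq0; apply/eqP/E0.
  by rewrite -(subrr y); exact: (subgroupB subE E1 E2).
have [w' w'E] : exists w' : {additive X -> D}, w' =1 w.
  apply: exists_additive => x y; apply: Efun (wE _) _.
  exact: (subgroupB subE (wE x) (wE y)).
by exists w' => a; rewrite w'E; apply: Efun (wE _) (Euv a).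
Qed.

End Extension.

Lemma countable_setTP T :
  countable [set: T] <-> exists f : T -> nat, injective f.
Proof.
split=> [/countable_injP[f finj]|[f finj]].
  by exists f => x y; apply: finj; rewrite inE.
by apply/countable_injP; exists f => x y _ _; exact: finj.
Qed.

Lemma surjective_section T U (f : T -> U) : range f = setT ->
  exists g : U -> T, cancel g f.
Proof.
move=> fsurj; suff /choice[g fg] : forall y, exists x, f x = y by exists g.
by move=> y; have [x _ <-] : range f y by [rewrite fsurj]; exists x.
Qed.

Lemma additive_factor (A X Y : zmodType) (u : {additive A -> X})
    (v : {additive A -> Y}) : range u = setT -> (forall a, u a = 0 -> v a = 0)
      ->
  exists w : {additive X -> Y}, forall a, w (u a) = v a.
Proof.
move=> usurj uv; have [s su] := surjective_section usurj.
have vsu a : v (s (u a)) = v a.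
  by apply/eqP; rewrite -subr_eq0 -raddfB uv // raddfB su subrr.
have [w wE] : exists w : {additive X -> Y}, w =1 v \o s.
  apply: exists_additive => x y /=.
  by rewrite -raddfB -[in LHS](su x) -[in LHS](su y) -raddfB vsu.
by exists w => a; rewrite wE /=.
Qed.

Definition divisible_ctbl_torsion (D : zmodType) :=
  [/\ countable [set: D], torsion D & divisible D].

Lemma divisible_ctbl_torsion_quotient (D Q : zmodType) (q : {additive D -> Q}) :
  range q = setT -> divisible_ctbl_torsion D -> divisible_ctbl_torsion Q.
Proof.
move=> qsurj [/countable_setTP[c cinj] torD divD].
have [s sq] := surjective_section qsurj; split.
- by apply/countable_setTP; exists (c \o s); apply: inj_comp => //;
    exact: can_inj sq.
- by move=> x; have [m m0 sxm] := torD (s x); exists m => //;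
    rewrite -(sq x) -raddfMn sxm raddf0.
move=> m x m0; have [d dm] := divD m (s x) m0.
by exists (q d); rewrite -raddfMn dm sq.
Qed.

(** * Divisible hulls of countable torsion groups *)

Section DivisibleHull.
Variables (A : zmodType) (a_ : nat -> A).

Let ev (q : {poly int}) : A := \sum_(i < size q) a_ i *~ q`_i.

Let ev_widen (q : {poly int}) n : (size q <= n)%N ->
  ev q = \sum_(i < n) a_ i *~ q`_i.
Proof.
move=> qn; rewrite /ev (big_ord_widen n (fun i => a_ i *~ q`_i)) // big_mkcond
  /=.
by apply: eq_bigr => i _; case: ltnP => // iq; rewrite nth_default.
Qed.

Lemma exists_poly_eval :
  exists e : {additive {poly int} -> A}, forall i, e 'X^i = a_ i.
Proof.
have [e eE] : exists e : {additive {poly int} -> A}, e =1 ev.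
  apply: exists_additive => p q.
  rewrite (@ev_widen (p - q) (maxn (size p) (size q))); last first.
    by rewrite -[X in maxn _ X]size_polyN size_polyD.
  rewrite (@ev_widen p (maxn (size p) (size q))) ?leq_maxl //.
  rewrite (@ev_widen q (maxn (size p) (size q))) ?leq_maxr //.
  by rewrite -sumrB; apply: eq_bigr => i _; rewrite coefB mulrzBr.
exists e => i; rewrite eE /ev size_polyXn big_ord_recr /= coefXn eqxx mulr1z.
by rewrite big1 ?add0r // => j _; rewrite coefXn ltn_eqF // mulr0z.
Qed.

End DivisibleHull.

(* Writing [A] as a quotient of the free group on [nat], realized as integer
   polynomials, embeds it into the same quotient of rational polynomials. *)
Lemma divisible_hull (A : zmodType) : countable [set: A] -> torsion A ->
  exists (D : zmodType) (j : {additive A -> D}),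
    injective j /\ divisible_ctbl_torsion D.
Proof.
move=> /countable_setTP[c cinj] torA.
(* [a_] inverts the numbering [c], with default value 0 outside its range. *)
have [a_ a_c] : exists a_ : nat -> A, cancel c a_.
  exists (fun n => xget 0 [set x | c x = n]) => x.
  by case: xgetP => [y yE /= /cinj //|none]; case: (none x).
have [e eX] := exists_poly_eval a_.
(* Since [A] is the quotient of integer polynomials by the kernel of [e], dividing rational
   polynomials by that same kernel makes [A] a subgroup of the result; this is [dint]. *)
pose K := map_poly intr @` [set q : {poly int} | e q = 0] : set {poly rat}.
have subK : subgroup K.
  split; first by exists 0; rewrite /= ?raddf0.
  move=> _ _ [p /= ep <-] [q /= eq <-]; exists (p - q); last by rewrite raddfB.
  by rewrite /= raddfB ep eq subrr.
have [D [d [dsurj dK]]] := quotient_exists subK.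
have dint q : d (map_poly intr q) = 0 <-> e q = 0.
  rewrite dK; split=> [[q' eq' qq']|eq0]; last by exists q.
  by have <- // : q' = q by apply: map_inj_poly qq' => //; exact: intr_inj.
have [j jE] : exists j : {additive A -> D}, j =1 fun a => d 'X^(c a).
  apply: exists_additive => x y; apply/eqP; rewrite -subr_eq0 -!raddfB /=.
  have -> : 'X^(c (x - y)) - ('X^(c x) - 'X^(c y)) =
      map_poly intr ('X^(c (x - y)) - ('X^(c x) - 'X^(c y)) : {poly int}) :>
        {poly rat}.
    by rewrite !raddfB /= !map_polyXn.
  by apply/eqP/dint; rewrite !raddfB /= !eX !a_c opprK addrACA subrr addNr
    addr0.
exists D, j; split.
  move=> x y /eqP; rewrite !jE -subr_eq0 -raddfB /=.
  have -> : 'X^(c x) - 'X^(c y) =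
      map_poly intr ('X^(c x) - 'X^(c y) : {poly int}) :> {poly rat}.
    by rewrite raddfB /= !map_polyXn.
  move=> /eqP/dint; rewrite raddfB /= !eX !a_c => /eqP.
  by rewrite subr_eq0 => /eqP.
have [s sd] := surjective_section dsurj; split.
- apply/countable_setTP; exists (pickle \o s).
  by apply: inj_comp; [exact: pcan_inj pickleK|exact: can_inj sd].
(* Clearing denominators, [a] times the representative of [x] is the integer polynomial [q], whose
   value [e q] is torsion. *)
- move=> x; have [q [a a0 sx]] := rat_poly_scale (s x).
  have [m m0 eqm] := torA (e q); exists (`|a| * m)%N.
    by rewrite muln_gt0 absz_gt0 a0.
  have dxa : x *~ a = d (map_poly intr q).
    rewrite -(sd x) -raddfMz sx -scaler_int scalerA divff ?scale1r //.
    by rewrite intr_eq0.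
  have : x *~ a *+ m = 0.
    by rewrite dxa -raddfMn; rewrite -raddfMn; apply/dint; rewrite raddfMn.
  case: (a) => n; first by rewrite mulrnA.
  by rewrite NegzE mulrNz -pmulrn mulNrn -mulrnA => /eqP;
    rewrite oppr_eq0 => /eqP.
move=> m x m0; exists (d (m%:R^-1 *: s x)).
rewrite -raddfMn -scaler_nat scalerA divff ?scale1r ?sd //.
by rewrite pnatr_eq0 -lt0n.
Qed.

(** * Filtered abelian groups *)

(** The fields express that [G] is the inverse limit of its quotients by the [fil n], and that these
    are countable and torsion, without forming any quotient: the fibres of [c] lie in single cosets,
    and completeness is the lifting of compatible sequences of cosets. *)
Record filtration (G : zmodType) := Filtration {
  fil :> nat -> set G;
  fil_subgroup : forall n, subgroup (fil n);
  filS : forall n, fil n.+1 `<=` fil n;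
  fil_separated : forall x, (forall n, fil n x) -> x = 0;
  fil_complete : forall x : nat -> G,
    (forall n, fil n (x n.+1 - x n)) -> exists g, forall n, fil n (g - x n);
  fil_countable : forall n,
    exists c : G -> nat, forall x y, c x = c y -> fil n (x - y);
  fil_torsion : forall n x, exists2 m, (0 < m)%N & fil n (x *+ m)
}.

Lemma fil_le (G : zmodType) (F : filtration G) m n :
  (m <= n)%N -> F n `<=` F m.
Proof.
move=> /subnK <-; elim: (n - m)%N => [|k IHk] //.
by apply: subset_trans IHk; exact: filS.
Qed.

Definition adapted (T : topologicalZmodType) (F : filtration T) :=
  forall (x : T) (U : set T),
    nbhs x U <-> exists n, forall y, F n (y - x) -> U y.

(** An alias of [G] that carries the metric and the group topology defined by [F]. *)
Definition filtered (R : realType) (G : zmodType) (F : filtration G) : Type :=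
  G.

(** * The metric of a filtration *)

Section FiltrationMetric.
Variables (R : realType) (G : zmodType) (F : filtration G).

(** With [n] the least index such that [x] is outside [F n], the norm is the inverse of [n.+1]; thus
    [F n] is the open ball of radius [n.+1%:R^-1] around 0. *)
Definition fil_norm (x : G) : R :=
  match pselect (exists n, ~~ `[< F n x >]) with
  | left ex => (ex_minn ex).+1%:R^-1
  | right _ => 0
  end.

Lemma invS_le (m n : nat) : (m.+1%:R^-1 <= n.+1%:R^-1 :> R) = (n <= m)%N.
Proof. by rewrite lef_pV2 ?posrE // ler_nat ltnS. Qed.

Lemma invS_lt (m n : nat) : (m.+1%:R^-1 < n.+1%:R^-1 :> R) = (n < m)%N.
Proof. by rewrite ltNge invS_le -ltnNge. Qed.

Lemma fil_norm_lt n x : fil_norm x < n.+1%:R^-1 <-> F n x.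
Proof.
rewrite /fil_norm; case: pselect => [ex|nex]; last first.
  split=> _; last by rewrite invr_gt0.
  by apply: contrapT => nFx; apply: nex; exists n; apply/asboolP.
case: ex_minnP => m /asboolP nFx minm; rewrite invS_lt.
split=> [nm|Fx].
  apply: contrapT => nFnx; suff : (m <= n)%N by rewrite leqNgt nm.
  by apply: minm; apply/asboolP.
by rewrite ltnNge; apply/negP => mn; apply: nFx; exact: fil_le mn _ Fx.
Qed.

Lemma fil_norm_ge0 x : 0 <= fil_norm x.
Proof. by rewrite /fil_norm; case: pselect => // ex; rewrite invr_ge0. Qed.

Lemma fil_norm0 : fil_norm 0 = 0.
Proof.
rewrite /fil_norm; case: pselect => // -[n /asboolP[]].
exact: (subgroup0 (fil_subgroup F n)).
Qed.

Lemma fil_norm_eq0 x : fil_norm x = 0 -> x = 0.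
Proof.
by move=> x0; apply: (fil_separated (f:=F)) => n; apply/fil_norm_lt;
  rewrite x0 invr_gt0.
Qed.

Lemma fil_normE x : fil_norm x = 0 \/ exists n, fil_norm x = n.+1%:R^-1.
Proof. by rewrite /fil_norm; case: pselect => [ex|]; [right; eexists|left]. Qed.

Lemma fil_norm_le x y : (forall n, F n y -> F n x) -> fil_norm x <= fil_norm y.
Proof.
move=> yx; have [->|[n xn]] := fil_normE x; first exact: fil_norm_ge0.
rewrite leNgt xn; apply/negP => /fil_norm_lt/yx/fil_norm_lt.
by rewrite xn ltxx.
Qed.

Lemma fil_normN x : fil_norm (- x) = fil_norm x.
Proof.
apply/le_anti/andP; split; apply: fil_norm_le => n Fx.
  exact: (subgroupN (fil_subgroup F n) Fx).
by rewrite -[x]opprK; exact: (subgroupN (fil_subgroup F n) Fx).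
Qed.

(** The ultrametric inequality holds: each [F n] containing the term of larger norm contains both
    terms, hence the sum. *)
Lemma fil_normD x y : fil_norm (x + y) <= fil_norm x + fil_norm y.
Proof.
have [xy|yx] := leP (fil_norm x) (fil_norm y).
  apply: (@le_trans _ _ (fil_norm y)); last by rewrite lerDr fil_norm_ge0.
  apply: fil_norm_le => n Fy; apply: (subgroupD (fil_subgroup F n) _ Fy).
  by apply/fil_norm_lt; apply: le_lt_trans xy _; apply/fil_norm_lt.
apply: (@le_trans _ _ (fil_norm x)); last by rewrite lerDl fil_norm_ge0.
apply: fil_norm_le => n Fx; apply: (subgroupD (fil_subgroup F n) Fx _).
by apply/fil_norm_lt; apply: lt_trans yx _; apply/fil_norm_lt.
Qed.

Local Notation filtered := (filtered R F).

HB.instance Definition _ := GRing.Zmodule.copy filtered G.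

Let dist (x y : filtered) : R := fil_norm (x - y).

Let distxx x : dist x x = 0.
Proof. by rewrite /dist subrr fil_norm0. Qed.

Let dist_eq0 x y : dist x y = 0 -> x = y.
Proof. by move=> /fil_norm_eq0/eqP; rewrite subr_eq0 => /eqP. Qed.

Let distC x y : dist x y = dist y x.
Proof. by rewrite /dist -fil_normN opprB. Qed.

Let dist_triangle y x z : dist x z <= dist x y + dist y z.
Proof. by rewrite /dist -(subrKA y) fil_normD. Qed.

HB.instance Definition _ :=
  isMetric.Build R filtered distxx dist_eq0 distC dist_triangle.

Lemma filtered_ball (x : filtered) n : ball x n.+1%:R^-1 = [set y | F n (x -
  y)].
Proof.
by apply/seteqP; split=> y; rewrite ballEmdist /=;
  [move/fil_norm_lt|move=> /fil_norm_lt].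
Qed.

Lemma filtered_nbhs (x : filtered) (U : set filtered) :
  nbhs x U <-> exists n, forall y, F n (y - x) -> U y.
Proof.
split=> [/nbhs_ballP[e e0 xU]|[n xU]].
  have /= e0' : 0 < e by [].
  exists (Num.truncn e^-1) => y Fyx; apply: xU.
  apply: (@le_ball _ _ _ (Num.truncn e^-1).+1%:R^-1).
    rewrite -[leRHS]invrK lef_pV2 ?posrE ?invr_gt0 //.
    exact/ltW/truncnS_gt.
  by rewrite filtered_ball /=; exact: (subgroupC (fil_subgroup F _) Fyx).
apply/nbhs_ballP; exists n.+1%:R^-1; first by rewrite /= invr_gt0.
move=> y; rewrite filtered_ball /= => /(subgroupC (fil_subgroup F n)).
exact: xU.
Qed.

Lemma filtered_sub_continuous :
  continuous (fun x : filtered * filtered => x.1 - x.2).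
Proof.
move=> [x y] U /= /filtered_nbhs[n xyU].
exists ([set x' | F n (x' - x)], [set y' | F n (y' - y)]) => /=.
  by split; apply/filtered_nbhs; exists n.
move=> [x' y'] /= [Fx Fy]; apply: xyU.
have -> : x' - y' - (x - y) = (x' - x) - (y' - y).
  exact: subrACA.
exact: (subgroupB (fil_subgroup F n) Fx Fy).
Qed.

HB.instance Definition _ :=
  PreTopologicalNmodule_isTopologicalZmodule.Build filtered
    filtered_sub_continuous.

(* [F] itself does not have this type: the abelian group [filtered] is an
   eta-expansion of [G]. *)
Definition filtered_filtration : filtration filtered :=
  @Filtration filtered F (@fil_subgroup _ F) (@filS _ F) (@fil_separated _ F)
    (@fil_complete _ F) (@fil_countable _ F) (@fil_torsion _ F).

Lemma filtered_adapted : @adapted filtered filtered_filtration.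
Proof. exact: filtered_nbhs. Qed.

(** One point for each value of each [c n] gives a countable dense set. A Cauchy filter contains a
    coset of every [F n]; representatives of these form a sequence to which [fil_complete]
    applies. *)
Lemma filtered_polish : polish R filtered.
Proof.
split.
  have [c cF] := choice (fil_countable F).
  pose d (p : nat * nat) := xget 0 [set x : filtered | c p.1 x = p.2].
  exists (range d); first exact: sub_countable (card_image_le _ _) (countableP
    _).
  move=> O [x Ox] oO.
  have /filtered_nbhs[n xO] : nbhs x O by exact: open_nbhs_nbhs.
  exists (d (n, c n x)); split; last by exists (n, c n x).
  apply: xO; apply: cF; rewrite /d; case: xgetP => [y _ //|none].
  by case: (none x).
exists filtered, idfun; split; last by split; [move=> x|exists idfun;
  split=> // x].
move=> U FU cU.
have small n : exists x : filtered, U [set y | F n (y - x)].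
  have [x Ux] := (cauchyP U).1 cU n.+1%:R^-1 ltac:(by rewrite invr_gt0).
  exists x; apply: filterS Ux => y; rewrite filtered_ball /=.
  exact: (subgroupC (fil_subgroup F n)).
have [x xU] := choice small.
have [n|g gx] := fil_complete (f:=F) (x:=x).
  have [y [/= y1 y2]] := filter_ex (filterI (xU n) (xU n.+1)).
  apply: (subgroup_trans (fil_subgroup F n) (y := y)); last exact: y1.
  by apply: (subgroupC (fil_subgroup F n)); exact: filS.
exists g => V /filtered_nbhs[n gV]; apply: filterS (xU n) => y /= yx.
apply: gV; apply: (subgroup_trans (fil_subgroup F n) yx).
by apply: (subgroupC (fil_subgroup F n)); exact: gx.
Qed.

End FiltrationMetric.

(** * Filtrations and inverse limits *)

Section InverseLimit.
Variables (A : nat -> zmodType) (p : forall n, {additive A n.+1 -> A n}).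

Local Notation prodA := (prod_topology (fun n => discrete_topology (A n))).

Lemma nbhs_prod_discrete (x : prodA) (U : set prodA) :
  nbhs x U <-> exists n, forall y : prodA, (forall i, (i < n)%N -> y i = x i)
    -> U y.
Proof.
split; last first.
  move=> [n xU]; apply: (@filterS _ _ _ [set y : prodA | forall i, (i < n)%N ->
    y i = x i]) => //.
  elim: n {xU} => [|n IHn]; first by apply: filterS filterT => y _ i.
  have nx : nbhs x [set y : prodA | y n = x n].
    have /(_ [set x n]) := @proj_continuous nat (fun n => discrete_topology (A
      n)) n x.
    by apply; rewrite nbhs_principalE.
  apply: filterS (filterI IHn nx) => y [yi yn] i.
  by rewrite ltnS leq_eqVlt => /orP[/eqP ->|/yi].
(* The sets containing a cylinder around [x] form a filter. It converges to [x] for the topology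
   induced by each coordinate, hence for their supremum, the product topology. *)
pose N : set_system prodA := [set U : set prodA |
  exists n, forall y, (forall i, (i < n)%N -> y i = x i) -> U y].
have NF : Filter N.
  split; first by exists 0%N.
  - move=> V W [n xV] [m xW]; exists (maxn n m) => y yx; split.
      by apply: xV => i ni; apply: yx; rewrite leq_max ni.
    by apply: xW => i ni; apply: yx; rewrite leq_max ni orbT.
  by move=> V W VW [n xV]; exists n => y /xV/VW.
have : N --> (x : prodA).
  apply/cvg_sup => i V [_ [[B _ <-] /= Bx] BV]; exists i.+1 => y yx.
  by apply: BV; rewrite /= yx.
exact.
Qed.

Lemma nbhs_inverse_limit (x : inverse_limit p) (U : set (inverse_limit p)) :
  nbhs x U <-> exists n, forall y : inverse_limit p,
    (forall i, (i < n)%N -> set_val y i = set_val x i) -> U y.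
Proof.
split=> [[_ [[V oV <-] /= Vx] VU]|[n xU]].
  have /nbhs_prod_discrete[n xV] : nbhs (set_val x) V by exact: open_nbhs_nbhs.
  by exists n => y yx; apply: VU; exact: xV.
pose V := [set y : prodA | forall i, (i < n)%N -> y i = set_val x i].
have nV : nbhs (set_val x) V by apply/nbhs_prod_discrete; exists n.
have nxV : nbhs x (set_val @^-1` V) := @initial_continuous _ _ _ x V nV.
by apply: filterS nxV => y; exact: xU.
Qed.

End InverseLimit.

(** The inverse sequence consists of the quotients by the [F n]. The map to its limit is injective
    by separatedness and surjective by completeness. *)
Lemma adapted_topological_torsion (T : topologicalZmodType) (F : filtration T) :
  adapted F -> topological_torsion T.
Proof.
move=> adF.
pose Q n := sval (cid (quotient_exists (fil_subgroup F n))).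
have /(_ _)/cid qP n := svalP (cid (quotient_exists (fil_subgroup F n))).
pose q n : {additive T -> Q n} := sval (qP n).
have qsurj n : range (q n) = setT by have [] := svalP (qP n).
have qE n x : q n x = 0 <-> F n x by have [] := svalP (qP n).
have qeq n x y : q n x = q n y <-> F n (x - y).
  by rewrite -qE raddfB; split=> [->|/eqP]; rewrite ?subrr // subr_eq0 => /eqP.
have /(_ _)/cid pP n : exists p : {additive Q n.+1 -> Q n}, forall x, p (q n.+1
  x) = q n x.
  by apply: additive_factor => // x /qE/filS Fx; exact/qE.
pose p n := sval (pP n); have pE n x : p n (q n.+1 x) = q n x := svalP (pP n) x.
exists Q, p; split.
  move=> n; split.
    have [c cF] := fil_countable F n; have [s sq] := surjective_section (qsurj
      n).
    apply/countable_setTP; exists (c \o s) => x y /= /cF/qeq.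
    by rewrite !sq.
  move=> x; have [s sq] := surjective_section (qsurj n).
  have [m m0 Fm] := fil_torsion F n (s x); exists m => //.
  by rewrite -(sq x) -raddfMn; exact/qE.
have fP x : (fun n => q n x) \in inverse_limit p by rewrite inE => n /=;
  exact: pE.
pose f x : inverse_limit p := exist (fun y => y \in inverse_limit p) _ (fP x).
have fE x n : set_val (f x) n = q n x by [].
have finj : injective f.
  move=> x y fxy; apply/eqP; rewrite -subr_eq0; apply/eqP.
  by apply: (fil_separated (f := F)) => n; apply/qeq; rewrite -!fE fxy.
have fsurj : range f = setT.
  apply/seteqP; split=> // y _.
  have [x xE] : exists x : nat -> T, forall n, q n (x n) = set_val y n.
    suff /choice[x xE] : forall n, exists x, q n x = set_val y n by exists x.
    move=> n; by have [x _ <-] : range (q n) (set_val y n) by [rewrite qsurj];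
      exists x.
  have [n|g gx] := fil_complete (f := F) (x := x).
    by apply/qeq; rewrite xE -pE xE; have := set_valP y; exact.
  exists g => //; apply: val_inj; apply: functional_extensionality_dep => n /=.
  by rewrite -[RHS]xE; exact/qeq.
have [g fg] := surjective_section fsurj.
exists f; split; last by move=> x y n; rewrite !fE raddfD.
split.
  move=> x U /nbhs_inverse_limit[n xU]; apply/adF; exists n => y yx.
  apply: xU => i /ltnW ni; rewrite !fE; apply/qeq; exact: fil_le ni _ yx.
exists g; split=> //; last by move=> x; apply: finj; rewrite fg.
move=> y U /adF[n yU]; apply/nbhs_inverse_limit; exists n.+1 => z zy.
by apply: yU; apply/qeq; rewrite -!fE !fg zy.
Qed.

(** The subgroups are the kernels of the projections [a n] to the terms of the inverse sequence. *)
Lemma topological_torsion_filtration (T : topologicalZmodType) :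
  topological_torsion T -> exists F : filtration T, adapted F.
Proof.
move=> [A [p [Actt [f [[fc [g [gc fg gf]] fD]]]]]].
have fp x n : p n (set_val (f x) n.+1) = set_val (f x) n.
  by have := set_valP (f x); exact.
have /(_ _)/cid aP n : exists a : {additive T -> A n}, forall x, a x = set_val
  (f x) n.
  apply: exists_additive => x y.
  by have := fD (x - y) y n; rewrite subrK => ->; rewrite addrK.
pose a n := sval (aP n); have aE n x : a n x = set_val (f x) n := svalP (aP n)
  x.
have pa n x : p n (a n.+1 x) = a n x by rewrite !aE fp.
pose K n := [set x | a n x = 0].
have Kle m n x : (m <= n)%N -> K n x -> K m x.
  move=> /subnK <-; elim: (n - m)%N => [|k IHk] //= Kx; apply: IHk.
  by rewrite /K /= -pa [a _ _]Kx raddf0.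
have KB n x y : K n (x - y) <-> a n x = a n y.
  by rewrite /K /= raddfB; split=> [/eqP|->];
    rewrite ?subrr // subr_eq0 => /eqP.
have sepa x y : (forall n, a n x = a n y) -> x = y.
  move=> xy; apply: (can_inj fg); apply: val_inj.
  by apply: functional_extensionality_dep => n; have := xy n; rewrite !aE.
have sep x : (forall n, K n x) -> x = 0.
  by move=> Kx; apply: sepa => n; rewrite raddf0; exact: Kx.
have lift (x : nat -> T) : (forall n, K n (x n.+1 - x n)) ->
    exists y, forall n, K n (y - x n).
  move=> xK; have zP : (fun n => a n (x n)) \in inverse_limit p.
    by rewrite inE => n /=; rewrite pa; exact/KB.
  pose z : inverse_limit p := exist (fun y => y \in inverse_limit p) _ zP.
  by exists (g z) => n; apply/KB; rewrite aE gf.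
have ctbl n : exists c : T -> nat, forall x y, c x = c y -> K n (x - y).
  have [/countable_setTP[c cinj] _] := Actt n.
  by exists (c \o a n) => x y /= /cinj/KB.
have tors n x : exists2 m, (0 < m)%N & K n (x *+ m).
  have [_ torA] := Actt n; have [m m0 axm] := torA (a n x).
  by exists m; rewrite // /K /= raddfMn.
exists (Filtration (fun n => subgroup_ker (a n)) (fun n x => @Kle n n.+1 x
  (leqnSn n))
  sep lift ctbl tors) => x U; split=> [xU|[n xU]].
  have : nbhs (f x) (g @^-1` U) by apply: gc; rewrite fg.
  move=> /nbhs_inverse_limit[n gU]; exists n => y /= Ky.
  rewrite -(fg y); apply: gU => i /ltnW ni; rewrite -!aE; apply/KB.
  exact: Kle ni Ky.
have : nbhs x (f @^-1` (g @^-1` U)).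
  apply: fc; apply/nbhs_inverse_limit; exists n.+1 => y yfx /=.
  by apply: xU; apply/KB; rewrite !aE gf yfx.
by apply: filterS => y /=; rewrite fg.
Qed.

Section Objects.
Variable R : realType.

Definition filtered_object (G : zmodType) (F : filtration G) : proTorPAb R :=
  @ProTorPAb R (filtered R F) (@filtered_polish R G F)
    (adapted_topological_torsion (@filtered_adapted R G F)).

Lemma object_filtration (A : proTorPAb R) : exists F : filtration A, adapted F.
Proof. exact/topological_torsion_filtration/carrier_topological_torsion. Qed.

Definition fil_of (A : proTorPAb R) : filtration A := sval (cid
  (object_filtration A)).

Lemma fil_of_adapted (A : proTorPAb R) : adapted (fil_of A).
Proof. exact: svalP (cid (object_filtration A)). Qed.

Lemma fil_openP (A : proTorPAb R) (F : filtration A) (U : set A) : adapted F ->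
  open U <-> forall x, U x -> exists n, forall y, F n (y - x) -> U y.
Proof.
by move=> adF; rewrite openE; split=> oU x /oU /adF.
Qed.

Lemma fil_continuousP (A B : proTorPAb R) (F : filtration A) (F' : filtration B)
    (f : {additive A -> B}) : adapted F -> adapted F' ->
  continuous f <-> forall n, exists m, forall x, F m x -> F' n (f x).
Proof.
move=> adF adF'; split=> [fc n|fF x U].
  have : nbhs (f 0) [set y | F' n y].
    by rewrite raddf0; apply/adF'; exists n => y; rewrite subr0.
  by move=> /fc /adF[m mF]; exists m => x Fx; apply: mF; rewrite subr0.
move=> /adF'[n nU]; have [m mF] := fF n; apply/adF; exists m => y /mF.
by rewrite raddfB => /nU.
Qed.

Lemma hom_fil (A B : proTorPAb R) (F : filtration A) (F' : filtration B)
    (f : hom A B) n : adapted F -> adapted F' ->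
  exists m, forall x, F m x -> F' n (f x).
Proof.
by move=> adF adF'; apply: (fil_continuousP f adF adF').1; exact: hom_continuous.
Qed.

Lemma exists_hom (A B : proTorPAb R) (F : filtration A) (F' : filtration B)
    (f : A -> B) : adapted F -> adapted F' -> {morph f : x y / x - y} ->
  (forall n, exists m, forall x, F m x -> F' n (f x)) ->
  exists g : hom A B, g =1 f.
Proof.
move=> adF adF' fB fF; have [g gE] := exists_additive fB.
have gc : continuous g.
  by apply/(fil_continuousP g adF adF') => n; have [m mF] := fF n;
    exists m => x /mF; rewrite gE.
by exists (Hom gc).
Qed.

End Objects.

(** * Short exact sequences *)

Section ShortExact.
Variable R : realType.
Implicit Types A B C D : proTorPAb R.

Lemma fil_open A (F : filtration A) n : adapted F -> open (F n).
Proof.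
move=> adF; apply/(fil_openP _ adF) => x Fx; exists n => y Fyx.
by rewrite -(subrK x y); exact: (subgroupD (fil_subgroup F n) Fyx Fx).
Qed.

(** The last hypothesis makes [i] a homeomorphism onto its range, and the range is closed as the
    kernel of a continuous map to a separated group. *)
Lemma short_exactI A B C (i : hom A B) (p : hom B C)
    (F : filtration A) (F' : filtration B) : adapted F -> adapted F' ->
  injective i -> range i = [set y | p y = 0] -> range p = setT ->
  (forall n, exists m, forall a, F' m (i a) -> F n a) -> short_exact i p.
Proof.
move=> adF adF' iinj ip psurj Fi; split=> //; split=> //.
  rewrite ip -openC; apply/(fil_openP _ adF') => x /= px0.
  have [n nFpx] : exists n, ~ fil_of C n (p x).
    by apply: contrapT => nex; apply: px0; apply: (fil_separated (f := fil_of
      C)) => n;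
       apply: contrapT => nF; apply: nex; exists n.
  have [m mF] := hom_fil p n adF' (@fil_of_adapted _ C).
  exists m => y /mF; rewrite raddfB => + py0; rewrite py0 sub0r => Fpx;
    apply: nFpx.
  by rewrite -[p x]opprK; exact: (subgroupN (fil_subgroup (fil_of C) n) Fpx).
move=> U oU.
(* The union of the cosets of [i x] modulo [F' m], for [x] in [U], whose trace on the range of [i]
   lies in the image of [U]. *)
exists [set y | exists x m, [/\ U x, F' m (y - i x) & forall a, F' m (i a) -> U
  (x + a)]].
  apply/(fil_openP _ adF') => y [x [m [Ux Fy FU]]]; exists m => z Fz.
  by exists x, m; split=> //; exact: (subgroup_trans (fil_subgroup F' m) Fz Fy).
apply/seteqP; split=> [_ [x Ux <-]|y [[x [m [Ux Fy FU]]] [b _ yb]]].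
  split; last by exists x.
  have [n nU] := (fil_openP U adF).1 oU x Ux; have [m mF] := Fi n.
  exists x, m; split=> // [|a /mF Fa]; last by apply: nU; rewrite addrC addKr.
  by rewrite subrr; exact: (subgroup0 (fil_subgroup F' m)).
exists b => //; have /FU : F' m (i (b - x)) by rewrite raddfB yb.
by rewrite addrC subrK.
Qed.

Lemma closed_embedding_fil A B (i : hom A B) (F : filtration A) (F' :
  filtration B) n :
  adapted F -> adapted F' -> closed_embedding i ->
  exists m, forall a, F' m (i a) -> F n a.
Proof.
move=> adF adF' [iinj _ iopen].
have [V oV UV] := iopen _ (fil_open n adF).
have V0 : V 0.
  suff [] : (V `&` range i) 0 by [].
  rewrite -UV; exists 0; last by rewrite raddf0.
  exact: (subgroup0 (fil_subgroup F n)).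
have [m mV] := (fil_openP V adF').1 oV _ V0; exists m => a Fa.
suff [b Fb /iinj <-] : (i @` F n) (i a) by [].
by rewrite UV; split; [apply: mV; rewrite subr0|exists a].
Qed.

(** * The open mapping theorem *)

Section OpenMapping.
Variables (B C : proTorPAb R) (p : hom B C) (F : filtration B) (F' : filtration
  C).
Hypotheses (adF : adapted F) (adF' : adapted F') (psurj : range p = setT).

(** The closure of [p (F m)]. *)
Let cl m y := forall n, exists u, F m u /\ F' n (y - p u).

Let cl_subgroup m : subgroup (cl m).
Proof.
split=> [n|x y xF yF n].
  exists 0; rewrite raddf0 subr0; split; first exact: (subgroup0 (fil_subgroup
    F m)).
  exact: (subgroup0 (fil_subgroup F' n)).
have [[u [Fu Fxu]] [v [Fv Fyv]]] := (xF n, yF n); exists (u - v).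
split; first exact: (subgroupB (fil_subgroup F m) Fu Fv).
have -> : x - y - p (u - v) = (x - p u) - (y - p v).
  by rewrite raddfB subrACA.
exact: (subgroupB (fil_subgroup F' n) Fxu Fyv).
Qed.

(* Baire category: countably many cosets of [p (F m)] cover [C]. If their
   closures had empty interior, one could successively avoid all of them. *)
Let cl_open m : exists n, F' n `<=` cl m.
Proof.
apply: contrapT => ncl.
have small n : exists z, F' n z /\ ~ cl m z.
  apply: contrapT => nz; apply: ncl; exists n => z Fz.
  by apply: contrapT => nclz; apply: nz; exists z.
have [c cF] := fil_countable F m.
(* The [b k] represent all cosets of [F m], with default value 0 when [c] does not take the value
   [k]. *)
pose b k := xget 0 [set x : B | c x = k].
have bF x : F m (x - b (c x)).
  by apply: cF; rewrite /b; case: xgetP => [y _ /= -> //|none]; case: (none x).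
(* A pair is the centre and the level of a ball. Each ball lies in the preceding one and misses the
   image of the coset of [b k]. *)
pose avoid k (yn yn' : C * nat) := [/\ (yn.2 < yn'.2)%N, F' yn.2 (yn'.1 - yn.1)
  &
  forall u, F m u -> ~ F' yn'.2 (yn'.1 - p (b k) - p u)].
have [|k [y n] _|s sP] := @dependent_choice_nat (C * nat) (fun _ _ => True)
  avoid.
- by exists (0, 0%N).
- have [z [Fz nclz]] := small n.
  (* If [y - p (b k)] is in the subgroup [cl m], adding [z], which is not, leaves it. *)
  have [y' [Fy' ncly']] : exists y', F' n (y' - y) /\ ~ cl m (y' - p (b k)).
    have [cly|ncly] := pselect (cl m (y - p (b k))); last first.
      by exists y; rewrite subrr; split=> //;
        exact: (subgroup0 (fil_subgroup F' n)).
    exists (y + z); split; first by rewrite addrAC subrr add0r.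
    move=> /(subgroupB (cl_subgroup m)) /(_ cly); apply: contra_not nclz.
    by rewrite opprB addrA subrK addrC addKr.
  have [n0 n0P] : exists n0, forall u, F m u -> ~ F' n0 (y' - p (b k) - p u).
    apply: contrapT => nn0; apply: ncly' => n0; apply: contrapT => nu.
    by apply: nn0; exists n0 => u Fu Fyu; apply: nu; exists u.
  exists (y', maxn n0 n.+1); split=> //; split=> /=; first exact: leq_maxr.
    exact: Fy'.
  by move=> u Fu /(fil_le (leq_maxl _ _)); exact: n0P.
pose y k := (s k).1; pose n k := (s k).2.
have n_ge k : (k <= n k)%N.
  by elim: k => // k IHk; have [_ [+ _ _]] := sP k; exact: leq_ltn_trans.
have n_mono k d : (n k <= n (k + d))%N.
  elim: d => [|d IHd]; rewrite ?addn0 // addnS.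
  by have [_ [+ _ _]] := sP (k + d)%N; move/ltnW; exact: leq_trans.
have yF k d : F' (n k) (y (k + d)%N - y k).
  elim: d => [|d IHd].
    by rewrite addn0 subrr; exact: (subgroup0 (fil_subgroup F' _)).
  apply: (subgroup_trans (fil_subgroup F' _)) IHd; rewrite addnS.
  by have [_ [_ + _]] := sP (k + d)%N; apply: fil_le; exact: n_mono.
have [k|g gF] := fil_complete (f := F') (x := y).
  by have := yF k 1%N; rewrite addn1; apply: fil_le.
(* Completeness only puts [g - y j] into [F' j]; the term [j = k + n k] reaches the level [n k]. *)
have gFn k : F' (n k) (g - y k).
  apply: (subgroup_trans (fil_subgroup F' _)) (yF k (n k)).
  by apply: fil_le (gF _); exact: leq_addl.
(* The limit [g] lies in all the balls, yet [x] is in the coset of [b (c x)], whose image was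
   avoided at stage [c x]. *)
have [x _ px] : range p g by rewrite psurj.
have [_ [_ _ /(_ _ (bF x))]] := sP (c x); apply.
rewrite -/(y _) -/(n _) raddfB opprB addrA subrK px.
by apply: (subgroupC (fil_subgroup F' _)).
Qed.

(** Successive approximation: an error in [F' (N (m + k))] lies in the closure of [p (F (m + k))],
    so an element of [F (m + k)] corrects it up to [F' (N (m + k.+1))]. The corrections add up by
    completeness of [B]. *)
Lemma open_mapping m : exists n, forall y, F' n y -> exists2 x, F m x & p x = y.
Proof.
(* Taking [N k] at least [k] makes the errors tend to 0. *)
have [N0 N0P] := choice cl_open; pose N k := maxn k (N0 k).
have NP k y : F' (N k) y -> cl k y by move=> /(fil_le (leq_maxr _ _)) /N0P.
exists (N m) => y Fy.
have [|k x [Fmx Fx]|x xP] := @dependent_choice_nat B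
    (fun k x => F m x /\ F' (N (m + k)%N) (y - p x)) (fun k x x' => F (m + k)%N
      (x' - x)).
- exists 0; rewrite addn0 raddf0 subr0; split=> //.
  exact: (subgroup0 (fil_subgroup F m)).
- have [u [Fu Fyu]] := NP _ _ Fx (N (m + k.+1)%N); exists (x + u).
  split; last by rewrite [x + u]addrC addrK.
  split; last by rewrite raddfD opprD addrA.
  by apply: (subgroupD (fil_subgroup F m) Fmx);
    exact: fil_le (leq_addr _ _) _ Fu.
have [k|g gF] := fil_complete (f := F) (x := x).
  by have [_] := xP k; apply: fil_le; exact: leq_addl.
exists g.
  by rewrite -(subrK (x m) g); apply: (subgroupD (fil_subgroup F m) (gF m));
    case: (xP m) => -[].
apply/eqP; rewrite -subr_eq0; apply/eqP/(fil_separated (f := F')) => n.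
have [j jF] := hom_fil p n adF adF'.
pose k := maxn j n; apply: (subgroup_trans (fil_subgroup F' n) (y := p (x k))).
  by rewrite -raddfB; apply: jF; apply: fil_le (gF k); exact: leq_maxl.
apply: (subgroupC (fil_subgroup F' n)); have [[_ +] _] := xP k.
apply: fil_le; rewrite /N (leq_trans (leq_maxr j n)) //.
by rewrite (leq_trans (leq_addl m k)) // leq_maxl.
Qed.

End OpenMapping.

Lemma short_exact_factor A B C D (i : hom A B) (p : hom B C) (f : hom B D) :
  short_exact i p -> (forall a, f (i a) = 0) -> exists g : hom C D, f =1 g \o p.
Proof.
move=> [_ ip psurj] fi.
have [b pb|g gE] := additive_factor (u := p) (v := f) psurj.
  by have [a _ <-] : range i b by [rewrite ip]; exact: fi.
have [h hE] : exists h : hom C D, h =1 g.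
  apply: (exists_hom (@fil_of_adapted _ C) (@fil_of_adapted _ D)) => [x y|n].
    exact: raddfB.
  have [m mF] := hom_fil f n (@fil_of_adapted _ B) (@fil_of_adapted _ D).
  have [k kF] := open_mapping (@fil_of_adapted _ B) (@fil_of_adapted _ C) psurj
    m.
  by exists k => y /kF[x /mF Fx <-]; rewrite gE.
by exists h => x; rewrite /= hE gE.
Qed.

End ShortExact.

(** * Products and injective resolutions *)

Definition dep_prod (D : nat -> zmodType) : Type := forall n, D n.

Section DependentProduct.
Variable D : nat -> zmodType.
Implicit Types x y : dep_prod D.

HB.instance Definition _ := gen_eqMixin (dep_prod D).
HB.instance Definition _ := gen_choiceMixin (dep_prod D).

Let zero : dep_prod D := fun n => 0.
Let opp x : dep_prod D := fun n => - x n.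
Let add x y : dep_prod D := fun n => x n + y n.

Let addA : associative add.
Proof.
by move=> x y z; apply: functional_extensionality_dep => n;
  rewrite /add addrA.
Qed.
Let addC : commutative add.
Proof.
by move=> x y; apply: functional_extensionality_dep => n;
  rewrite /add addrC.
Qed.
Let add0 : left_id zero add.
Proof.
by move=> x; apply: functional_extensionality_dep => n;
  rewrite /add add0r.
Qed.
Let addN : left_inverse zero opp add.
Proof.
by move=> x; apply: functional_extensionality_dep => n;
  rewrite /add addNr.
Qed.

HB.instance Definition _ := GRing.isZmodule.Build (dep_prod D) addA addC add0
  addN.

Definition coord n x : D n := x n.

Let coordB n : {morph @coord n : x y / x - y}.
Proof. by []. Qed.

HB.instance Definition _ n :=
  GRing.isZmodMorphism.Build (dep_prod D) (D n) (@coord n) (@coordB n).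

Lemma dep_prodP x y : (forall n, coord n x = coord n y) -> x = y.
Proof. by move=> xy; apply: functional_extensionality_dep. Qed.

Hypothesis Dct : forall n, countable [set: D n] /\ torsion (D n).

Definition initially_zero n : set (dep_prod D) :=
  [set x | forall i, (i < n)%N -> coord i x = 0].

Lemma dep_prod_filtration_exists :
  exists F : filtration (dep_prod D), F = initially_zero :> (nat -> set _).
Proof.
have sub n : subgroup (initially_zero n).
  split=> [i _|x y x0 y0 i ni]; first by rewrite raddf0.
  by rewrite raddfB /= x0 ?y0 ?subr0.
have dec n : initially_zero n.+1 `<=` initially_zero n.
  by move=> x x0 i /ltnW; exact: x0.
have sep x : (forall n, initially_zero n x) -> x = 0.
  by move=> x0; apply: dep_prodP => n; rewrite raddf0; exact: (x0 n.+1).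
have lim (x : nat -> dep_prod D) : (forall n, initially_zero n (x n.+1 - x n))
  ->
    exists g, forall n, initially_zero n (g - x n).
  (* Coordinate [i] of [x n] no longer changes from [n = i.+1] on. *)
  move=> xS; pose g : dep_prod D := fun i => coord i (x i.+1).
  exists g => n i ni; rewrite raddfB /=; apply/eqP; rewrite subr_eq0; apply/eqP.
  rewrite -(subnKC ni); elim: (n - i.+1)%N => [|k ->]; first by rewrite addn0.
  rewrite addnS; apply/esym/eqP; rewrite -subr_eq0 -(raddfB (coord i));
    apply/eqP/xS.
  by rewrite addSn ltnS leq_addr.
have ctbl n : exists c : dep_prod D -> nat,
    forall x y, c x = c y -> initially_zero n (x - y).
  elim: n => [|n [c cP]]; first by exists (fun=> 0%N).
  have [/countable_setTP[d dinj] _] := Dct n.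
  exists (fun x => pickle (c x, d (coord n x))) => x y /(pcan_inj pickleK)[/cP
    xy /dinj xyn].
  move=> i; rewrite ltnS leq_eqVlt => /orP[/eqP ->|]; last exact: xy.
  by rewrite raddfB /= xyn subrr.
have tors n x : exists2 m, (0 < m)%N & initially_zero n (x *+ m).
  elim: n => [|n [m m0 xm]]; first by exists 1%N.
  have [_ torD] := Dct n; have [k k0 xk] := torD (coord n x).
  exists (k * m)%N; first by rewrite muln_gt0 k0.
  move=> i; rewrite ltnS leq_eqVlt => /orP[/eqP ->|i_n].
    by rewrite raddfMn /= mulrnA xk mul0rn.
  by rewrite mulnC mulrnA raddfMn /= xm // mul0rn.
by exists (Filtration sub dec sep lim ctbl tors).
Qed.

End DependentProduct.

Section Products.
Variable R : realType.
Implicit Types A B C : proTorPAb R.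

(** Characterizes [I] as the topological product of the discrete groups [D n] by its projections
    alone. *)
Record product_presentation (D : nat -> zmodType) (I : proTorPAb R) := Product {
  pr : forall n, {additive I -> D n};
  pr_fil : filtration I;
  pr_adapted : adapted pr_fil;
  pr_filE : forall n x, pr_fil n x <-> forall i, (i < n)%N -> pr i x = 0;
  pr_lift : forall y : (forall n, D n), exists x, forall n, pr n x = y n
}.

Lemma product_exists (D : nat -> zmodType) :
  (forall n, countable [set: D n] /\ torsion (D n)) ->
  exists I, inhabited (product_presentation D I).
Proof.
move=> Dct; have [F FE] := dep_prod_filtration_exists Dct.
exists (filtered_object R F).
have /(_ _)/cid prP n : exists f : {additive filtered_object R F -> D n},
    f =1 (fun x : dep_prod D => coord n x).
  by apply: exists_additive => x y; exact: raddfB.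
constructor; apply: (@Product D (filtered_object R F) (fun n => sval (prP n))
  (filtered_filtration R F) (@filtered_adapted R _ F)).
- move=> n x; rewrite /= FE; split=> xn i /xn; by rewrite (svalP (prP i)).
- by move=> y; exists (y : dep_prod D) => n; rewrite (svalP (prP n)).
Qed.

Section ProductTheory.
Variables (D : nat -> zmodType) (I : proTorPAb R) (P : product_presentation D
  I).

Lemma pr_inj x y : (forall n, pr P n x = pr P n y) -> x = y.
Proof.
move=> xy; apply/eqP; rewrite -subr_eq0; apply/eqP.
apply: (fil_separated (f := pr_fil P)) => n; apply/pr_filE => i _.
by rewrite raddfB xy subrr.
Qed.

(** The universal property of the product; the hypothesis on [f n] is its continuity into the
    discrete group [D n]. *)
Lemma exists_hom_product A (F : filtration A) (f : forall n, {additive A -> D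
  n}) :
  adapted F -> (forall n, exists m, forall x, F m x -> f n x = 0) ->
  exists g : hom A I, forall x n, pr P n (g x) = f n x.
Proof.
move=> adF fF; have /choice[g gE] x := pr_lift P (fun n => f n x).
have [h hE] : exists h : hom A I, h =1 g.
  apply: (exists_hom adF (pr_adapted P)) => [x y|n].
    by apply: pr_inj => n; rewrite raddfB !gE raddfB.
  have [m mF] := choice fF; exists (\max_(i < n) m i)%N => x Fx.
  apply/pr_filE => i i_n; rewrite gE; apply: mF; apply: fil_le Fx.
  exact: (leq_bigmax (Ordinal i_n)).
by exists h => x n; rewrite hE gE.
Qed.

Lemma pr_hom_continuous A (F : filtration A) (f : hom A I) n : adapted F ->
  exists m, forall x, F m x -> pr P n (f x) = 0.
Proof.
move=> adF.
have [m mF] := hom_fil f n.+1 adF (pr_adapted P).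
by exists m => x /mF/pr_filE; apply.
Qed.

Lemma product_extension A B (i : hom A B) (f : hom A I) :
  (forall n, divisible (D n)) -> closed_embedding i ->
  exists g : hom B I, f =1 g \o i.
Proof.
move=> divD iemb; pose F := fil_of A; pose F' := fil_of B.
have adF : adapted F := @fil_of_adapted _ A.
have adF' : adapted F' := @fil_of_adapted _ B.
have /(_ _)/cid gP n : exists g : {additive B -> D n},
    (forall a, g (i a) = pr P n (f a)) /\ exists m, forall x, F' m x -> g x = 0.
  (* Component [n] of [f] kills some [F m], which contains the preimage of some [F' k]. So it
     factors through the image of [A] in the quotient of [B] by [F' k], and divisibility extends it
     to this quotient. *)
  have [m mF] := pr_hom_continuous f n adF.
  have [k kF] := closed_embedding_fil m adF adF' iemb.
  have [Q [q [_ qF]]] := quotient_exists (fil_subgroup F' k).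
  have [|w wE] := @divisible_extension A Q (D n) (q \o i) (pr P n \o f) (divD
    n).
    by move=> a /qF/kF/mF.
  exists (w \o q); split; first exact: wE.
  by exists k => x /qF /= ->; rewrite raddf0.
have [|g gE] := @exists_hom_product B F' (fun n => sval (gP n)) adF'.
  by move=> n; have [] := svalP (gP n).
exists g => a; apply: pr_inj => n; rewrite gE.
by have [-> _] := svalP (gP n).
Qed.

Lemma product_injective : (forall n, divisible (D n)) -> injective_object I.
Proof.
move=> divD A B C i p ex; have [iemb ip psurj] := ex; split.
- move=> f g fg y; have [x _ <-] : range p y by rewrite psurj.
  exact: fg.
- move=> f; split=> [/(short_exact_factor ex)//|[g fg] x].
  rewrite fg /=; have -> : p (i x) = 0 by have : range i (i x) by [exists x];
    rewrite ip.
  exact: raddf0.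
- by move=> f; exact: product_extension.
Qed.

End ProductTheory.
End Products.

(** * Injective resolutions and biproducts *)

Section Resolution.
Variable R : realType.
Implicit Types A B C : proTorPAb R.

Lemma quotient_divisible_hull (G : zmodType) (F : filtration G) n :
  exists (D : zmodType) (h : {additive G -> D}),
    divisible_ctbl_torsion D /\ forall x, h x = 0 <-> F n x.
Proof.
have [Q [q [qsurj qF]]] := quotient_exists (fil_subgroup F n).
have [s sq] := surjective_section qsurj.
have qeq x y : q x = q y <-> F n (x - y).
  by rewrite -qF raddfB; split=> [->|/eqP]; rewrite ?subrr // subr_eq0 => /eqP.
have [||D [j [jinj Dct]]] := @divisible_hull Q.
- have [c cF] := fil_countable F n; apply/countable_setTP; exists (c \o s).
  by move=> x y /= /cF/qeq; rewrite !sq.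
- move=> x; have [m m0 Fm] := fil_torsion F n (s x); exists m => //.
  by rewrite -(sq x) -raddfMn; exact/qF.
exists D, (j \o q); split=> // x; rewrite -qF /=.
by split=> [jq0|->]; [apply: jinj|]; rewrite ?raddf0.
Qed.

(* [I] is the product of divisible hulls [D n] of [A / F n], and [C] that of the
   quotients [E n] of [D n] by the image of [F n.-1] (of [A] if [n = 0]). The map
   [s n] corrects the coordinate [n.+1] of [I -> C] so that [A] is sent to [0]. *)
Theorem injective_resolution A :
  exists (I C : proTorPAb R) (i : hom A I) (p : hom I C),
    [/\ injective_object I, injective_object C & short_exact i p].
Proof.
pose F := fil_of A; have adF : adapted F := @fil_of_adapted _ A.
pose D n := sval (cid (quotient_divisible_hull F n)).
have /(_ _)/cid hP n := svalP (cid (quotient_divisible_hull F n)).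
pose h n : {additive A -> D n} := sval (hP n).
have Dct n : divisible_ctbl_torsion (D n) by have [] := svalP (hP n).
have hF n x : h n x = 0 <-> F n x by have [] := svalP (hP n).
pose F1 n := if n is m.+1 then F m else [set: A].
have F1sub n : subgroup (F1 n) by case: n => // n; exact: fil_subgroup.
have qe n := quotient_exists (subgroup_image (h n) (F1sub n)).
pose E n := sval (cid (qe n)).
have /(_ _)/cid eP n := svalP (cid (qe n)).
pose e n : {additive D n -> E n} := sval (eP n).
have esurj n : range (e n) = setT by have [] := svalP (eP n).
have eE n x : e n x = 0 <-> (h n @` F1 n) x by have [] := svalP (eP n).
have Ect n : divisible_ctbl_torsion (E n).
  exact: divisible_ctbl_torsion_quotient (esurj n) (Dct n).
(* If [h n a = 0] then [a] is in [F n], so [e n.+1] kills [h n.+1 a]; the prescription is consistent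
   and extends by divisibility of [E n.+1]. *)
have /(_ _)/cid sP n : exists s : {additive D n -> E n.+1},
    forall a, s (h n a) = e n.+1 (h n.+1 a).
  apply: (@divisible_extension _ _ _ (h n) (e n.+1 \o h n.+1)) => [|a /hF Fa
    /=].
    by have [] := Ect n.+1.
  by apply/eE; exists a.
pose s n : {additive D n -> E n.+1} := sval (sP n).
have sE n a : s n (h n a) = e n.+1 (h n.+1 a) := svalP (sP n) a.
have [I [PI]] : exists I, inhabited (product_presentation (R := R) D I).
  by apply: product_exists => n; have [] := Dct n.
have [C [PC]] : exists C, inhabited (product_presentation (R := R) E C).
  by apply: product_exists => n; have [] := Ect n.
have [i iE] : exists i : hom A I, forall x n, pr PI n (i x) = h n x.
  by apply: (exists_hom_product PI adF) => n; exists n => x /hF.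
have /(_ _)/cid phiP n : exists phi : {additive I -> E n}, forall x,
    phi x = e n (pr PI n x) - (if n is m.+1 return E n then s m (pr PI m x)
      else 0).
  by apply: exists_additive => x y; case: n => [|n];
    rewrite [RHS]subrACA !raddfB /= ?subr0 ?subrr ?addr0.
have [p pE] : exists p : hom I C, forall x n, pr PC n (p x) = sval (phiP n) x.
  apply: (exists_hom_product PC (pr_adapted PI)) => n; exists n.+1 => x.
  move=> /pr_filE x0; rewrite (svalP (phiP n)) x0 // raddf0 sub0r.
  by case: n x0 => [|n] x0; rewrite ?x0 ?raddf0 ?oppr0.
exists I, C, i, p; split.
- by apply: (product_injective PI) => n; have [] := Dct n.
- by apply: (product_injective PC) => n; have [] := Ect n.
have pE0 x : pr PC 0 (p x) = e 0%N (pr PI 0 x) by rewrite pE (svalP (phiP _))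
  subr0.
have pES x n : pr PC n.+1 (p x) = e n.+1 (pr PI n.+1 x) - s n (pr PI n x).
  by rewrite pE (svalP (phiP _)).
apply: (short_exactI adF (pr_adapted PI)).
- move=> x y ixy; apply/eqP; rewrite -subr_eq0; apply/eqP.
  by apply: (fil_separated (f := F)) => n; apply/hF;
    rewrite raddfB -!iE ixy subrr.
- apply/seteqP; split=> [_ [a _ <-] /=|x /= px0].
    apply: (pr_inj (P := PC)) => -[|n]; rewrite raddf0.
      by rewrite pE0 iE; apply/eE; exists a.
    by rewrite pES !iE sE subrr.
  (* The element [a n] of [A] matches [x] in coordinate [n]. As coordinate [n.+1] of [p x] is 0, it
     matches [x] in coordinate [n.+1] up to [h n.+1 b] for some [b] in [F n], and adding [b] gives
     the next term. *)
  have [|n a ax|a aP] := @dependent_choice_nat A (fun n a => h n a = pr PI n x)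
      (fun n a b => F n (b - a)).
  + have /eE[a _ ax] : e 0%N (pr PI 0 x) = 0 by rewrite -pE0 px0 raddf0.
    by exists a.
  + have : e n.+1 (pr PI n.+1 x - h n.+1 a) = 0.
      by rewrite raddfB -sE ax -pES px0 raddf0.
    move=> /eE[b Fb bx]; exists (b + a); rewrite addrK; split=> //.
    by rewrite raddfD bx subrK.
  have [n|g gF] := fil_complete (f := F) (x := a); first by have [] := aP n.
  exists g => //; apply: (pr_inj (P := PI)) => n; rewrite iE.
  have [<- _] := aP n; apply/eqP; rewrite -subr_eq0 -raddfB.
  by apply/eqP/hF/gF.
- apply/seteqP; split=> // y _.
  have /(_ _)/cid rP n := surjective_section (esurj n).
  pose r n : E n -> D n := sval (rP n).
  have rE n z : e n (r n z) = z := svalP (rP n) z.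
  (* Coordinate [n.+1] of [p] is [e n.+1] of coordinate [n.+1] minus [s n] of coordinate [n], so a
     preimage of [y] is solved for recursively. *)
  pose x := fix x n : D n := match n return D n with
    | 0 => r 0%N (pr PC 0 y)
    | m.+1 => r m.+1 (pr PC m.+1 y + s m (x m))
    end.
  have [z zE] := pr_lift PI x; exists z => //;
    apply: (pr_inj (P := PC)) => -[|n].
    by rewrite pE0 zE /= rE.
  by rewrite pES !zE /= rE addrK.
- move=> n; exists n.+1 => a /pr_filE /(_ n (ltnSn n)); rewrite iE.
  by move=> /hF.
Qed.

Lemma exists_zero_hom A B : exists f : hom A B, forall x, f x = 0.
Proof.
apply: (exists_hom (@fil_of_adapted _ A) (@fil_of_adapted _ B)) => [x y|n].
  by rewrite subr0.
by exists 0%N => x _; exact: (subgroup0 (fil_subgroup _ n)).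
Qed.

(** [M] is the product with the product filtration. Of the map with components [f] and [g], the last
    clause retains the second component and the value where [g] vanishes, which suffices to build
    morphisms of extensions. *)
Lemma biproduct_exists C A : exists (M : proTorPAb R) (i : hom C M) (p : hom M
  A),
  short_exact i p /\ forall X (f : hom X C) (g : hom X A), exists h : hom X M,
    forall x, p (h x) = g x /\ (g x = 0 -> h x = i (f x)).
Proof.
pose F := fil_of C; pose F' := fil_of A; pose G : zmodType := (C * A)%type.
have adF : adapted F := @fil_of_adapted _ C.
have adF' : adapted F' := @fil_of_adapted _ A.
pose K n : set G := [set x | F n x.1 /\ F' n x.2].
have sub n : subgroup (K n).
  split; first by split; [exact: (subgroup0 (fil_subgroup F n))|exact:
    (subgroup0 (fil_subgroup F' n))].
  move=> x y [x1 x2] [y1 y2]; split.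
    exact: (subgroupB (fil_subgroup F n) x1 y1).
  exact: (subgroupB (fil_subgroup F' n) x2 y2).
have dec n : K n.+1 `<=` K n by move=> x [/filS x1 /filS x2].
have sep x : (forall n, K n x) -> x = 0.
  move=> Kx; rewrite [x]surjective_pairing; congr pair.
    by apply: (fil_separated (f := F)) => n; case: (Kx n).
  by apply: (fil_separated (f := F')) => n; case: (Kx n).
have lim (x : nat -> G) : (forall n, K n (x n.+1 - x n)) -> exists g, forall n,
  K n (g - x n).
  move=> Kx.
  have [n|g1 g1P] := fil_complete (f := F) (x := fun n => (x n).1);
    first by case: (Kx n).
  have [n|g2 g2P] := fil_complete (f := F') (x := fun n => (x n).2);
    first by case: (Kx n).
  by exists (g1, g2) => n; split; [exact: g1P|exact: g2P].
have ctbl n : exists c : G -> nat, forall x y, c x = c y -> K n (x - y).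
  have [[c cF] [c' cF']] := (fil_countable F n, fil_countable F' n).
  exists (fun x => pickle (c x.1, c' x.2)) => x y /(pcan_inj pickleK)[/cF xy1
    /cF' xy2].
  by split.
have tors n x : exists2 m, (0 < m)%N & K n (x *+ m).
  have [m m0 Fm] := fil_torsion F n x.1; have [m' m'0 Fm'] := fil_torsion F' n
    x.2.
  exists (m * m')%N; first by rewrite muln_gt0 m0.
  split; rewrite raddfMn; first by rewrite mulrnA;
    exact: (subgroupMn (fil_subgroup F n) m' Fm).
  by rewrite mulnC mulrnA; exact: (subgroupMn (fil_subgroup F' n) m Fm').
pose FK := Filtration sub dec sep lim ctbl tors.
pose M := filtered_object R FK.
have adM : @adapted M (filtered_filtration R FK) := @filtered_adapted R G FK.
have [i iE] : exists i : hom C M, i =1 (fun c => (c, 0) : G).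
  apply: (exists_hom adF adM) => [x y|n]; first by congr pair; rewrite /= subr0.
  exists n => x Fx; split=> //=; exact: (subgroup0 (fil_subgroup F' n)).
have [p pE] : exists p : hom M A, p =1 (fun x : G => x.2).
  by apply: (exists_hom adM adF') => [x y //|n]; exists n => x [].
exists M, i, p; split.
  apply: (short_exactI adF adM).
  - by move=> x y; rewrite !iE => -[].
  - apply/seteqP; split=> [_ [c _ <-]|x /=]; first by rewrite /= iE pE.
    rewrite pE; case: x => [c a] /= ->; exists c => //; exact: iE.
  - by apply/seteqP; split=> // a _; exists ((0, a) : G); rewrite // pE.
  by move=> n; exists n => c; rewrite iE => -[].
move=> X f g.
have [h hE] : exists h : hom X M, h =1 (fun x => (f x, g x) : G).
  apply: (exists_hom (@fil_of_adapted _ X) adM) => [x y|n].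
    by congr pair; rewrite raddfB.
  have [m mF] := hom_fil f n (@fil_of_adapted _ X) adF.
  have [k kF] := hom_fil g n (@fil_of_adapted _ X) adF'.
  exists (maxn m k) => x Fx; split.
    by apply: mF; apply: fil_le Fx; exact: leq_maxl.
  by apply: kF; apply: fil_le Fx; exact: leq_maxr.
by exists h => x; rewrite hE pE iE; split=> // ->.
Qed.

End Resolution.

(** * Yoneda extensions *)

Section Ext.
Variable R : realType.
Implicit Types A B C : proTorPAb R.

Lemma exists_comp A B C (f : hom A B) (g : hom B C) :
  exists h : hom A C, h =1 g \o f.
Proof.
have c : continuous (g \o f).
  move=> x; apply: continuous_comp; exact: hom_continuous.
have [h hE] := @exists_additive A C (g \o f) (raddfB (g \o f)).
have hc : continuous h by rewrite (_ : h = g \o f :> (A -> C)) //;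
  exact: funext.
by exists (Hom hc).
Qed.

Lemma ses_mapping A B (E : ses B A) x : ses_proj E (ses_inj E x) = 0.
Proof.
have [_ ex _] := ses_exact E.
have : range (ses_inj E) (ses_inj E x) by exists x.
by rewrite ex.
Qed.

(** Once [k] extends to [l] on the middle term, the map with components [l] and [a \o ses_proj s] is
    a morphism to the split extension. *)
Lemma ses_extend_morphism A A' K K' (s : ses K A) (k : hom K K') (a : hom A A')
    (M : proTorPAb R) (i : hom K' M) (p : hom M A') (ex : short_exact i p)
    (l : hom (ses_mid s) K') :
  (forall X (f : hom X K') (g : hom X A'), exists h : hom X M,
    forall x, p (h x) = g x /\ (g x = 0 -> h x = i (f x))) ->
  k =1 l \o ses_inj s -> ses_morphism k a s (Ses ex).
Proof.
move=> univ kl; have [g gE] := exists_comp (ses_proj s) a.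
have [h hE] := univ _ l g; exists h; split=> x /=.
  have [_ ->] := hE (ses_inj s x); first by rewrite kl.
  by rewrite gE /= ses_mapping raddf0.
by have [-> _] := hE x; rewrite gE.
Qed.

(* Any extension of length at least two maps to a fixed one: its tail maps to
   an injective resolution [0 -> B -> I -> C -> 0] by injectivity of [I], and
   the induced map to the injective object [C] extends to the next term. *)
Lemma weakly_terminal_yext n A' B : exists Z : yext n.+2 A' B,
  forall A (a : hom A A') (E : yext n.+2 A B), yext_morphism a (id_hom B) E Z.
Proof.
elim: n => [|n IHn] in A' *.
  have [I [C [i [p [injI injC exip]]]]] := injective_resolution B.
  (* [Z] splices the split extension of [A'] by [C] with the resolution of [B]. *)
  have [M [j [q [exjq univ]]]] := biproduct_exists C A'.
  exists (@Splice R (fun K => yext 1 K B) A' C (Ses exjq) (Ses exip)).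
  move=> A a [K s t] /=.
  have [_ _ /(_ i)[g ig]] := injI _ _ _ _ _ (ses_exact t).
  have [pg pgE] := exists_comp g p.
  have [x|k kE] := short_exact_factor (f := pg) (ses_exact t).
    rewrite pgE /= -[g _]ig; have [_ ex _] := exip.
    have : range i (i x) by exists x.
    by rewrite ex.
  have [_ _ /(_ k)[l kl]] := injC _ _ _ _ _ (ses_exact s).
  exists k; split; first exact: (ses_extend_morphism a exjq univ kl).
  exists g; split=> x /=; first by rewrite ig.
  by rewrite -[LHS]kE pgE.
have [Z ZP] := IHn A'; have [M [j [q [exjq univ]]]] := biproduct_exists A' A'.
exists (@Splice R (fun K => yext n.+2 K B) A' A' (Ses exjq) Z).
move=> A a [K s t].
(* The induction hypothesis allows any map on [K]; the zero map extends to the middle term. *)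
have [k k0] := exists_zero_hom K A'; have [l l0] := exists_zero_hom (ses_mid s)
  A'.
exists k; split; last exact: ZP.
apply: (ses_extend_morphism a exjq univ (l := l)) => x.
by rewrite k0 /= l0.
Qed.

(** Any two extensions are joined by a zigzag through the common target [Z]. *)
Lemma Ext_trivial_above1 : Ext_trivial_above R 1.
Proof.
move=> [|[|n]] // _ A B E E'; have [Z ZP] := weakly_terminal_yext n A B.
apply: rst_trans (rst_step _ _ _ _ (ZP _ (id_hom A) E)) _.
exact: rst_sym (rst_step _ _ _ _ (ZP _ (id_hom A) E')).
Qed.

(** An invariant of Yoneda classes that obstructs splitting: in a split extension, every [a] with
    [a *+ 2 = 0] has such a lift. *)
Definition order2_lift A B (a : A) (E : ses B A) :=
  exists2 x, ses_proj E x = a & x *+ 2 = 0.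

(** The direction from [E'] back to [E] is a diagram chase as in the five lemma. *)
Lemma order2_lift_morphism A B (a : A) (E E' : ses B A) :
  ses_morphism (id_hom B) (id_hom A) E E' ->
  order2_lift a E <-> order2_lift a E'.
Proof.
have [[iinj _ _] ex psurj] := ses_exact E; have [[iinj' _ _] ex' _] :=
  ses_exact E'.
move=> [e [ei pe]].
have {}ei b : e (ses_inj E b) = ses_inj E' b := ei b.
have {}pe x : ses_proj E x = ses_proj E' (e x) := pe x.
split=> [[x px x2]|[x' px' x2']].
  by exists (e x); [rewrite -pe|rewrite -raddfMn x2 raddf0].
have [y _ py] : range (ses_proj E) a by rewrite psurj.
(* Both [e y] and [x'] lift [a], so they differ by an element of [B], which is subtracted from
   [y]. *)
have [b _ yb] : range (ses_inj E') (e y - x').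
  by rewrite ex' /= raddfB -pe py px' subrr.
pose x := y - ses_inj E b.
have exx' : e x = x' by rewrite raddfB ei yb subKr.
exists x; first by rewrite raddfB ses_mapping subr0.
have e2 : e (x *+ 2) = 0 by rewrite raddfMn exx'.
(* The element [x *+ 2] is killed by [e], hence comes from [B], where [e] is injective. *)
have [c _ cE] : range (ses_inj E) (x *+ 2) by rewrite ex /= pe e2 raddf0.
rewrite -cE; suff -> : c = 0 by rewrite raddf0.
by apply: iinj'; rewrite -ei cE e2 raddf0.
Qed.

Lemma order2_lift_equiv A B (a : A) (E E' : ses B A) :
  yoneda_equiv (n := 1) E E' -> order2_lift a E <-> order2_lift a E'.
Proof.
elim=> {E E'} [E E' /order2_lift_morphism //|//|E E' _ ->//|E E' E'' _ -> _ ->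
  //].
Qed.

Lemma discrete_filtration (G : zmodType) : countable [set: G] -> torsion G ->
  exists F : filtration G, forall n x, F n x <-> x = 0.
Proof.
move=> ctG torG; pose K (n : nat) : set G := [set x | x = 0].
have sub n : subgroup (K n).
  by split=> // x y /= -> ->; rewrite /K /= subr0.
have dec n : K n.+1 `<=` K n by [].
have sep x : (forall n, K n x) -> x = 0 by move=> /(_ 0%N).
have lim (x : nat -> G) : (forall n, K n (x n.+1 - x n)) -> exists g, forall n,
  K n (g - x n).
  move=> Kx; exists (x 0%N); elim=> [|n IHn]; rewrite /K /= ?subrr //.
  by rewrite -(subrKA (x n)) IHn add0r -opprB Kx oppr0.
have ctbl n : exists c : G -> nat, forall x y, c x = c y -> K n (x - y).
  have /countable_setTP[c cinj] := ctG; exists c => x y /cinj ->.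
  by rewrite /K /= subrr.
by exists (Filtration sub dec sep lim ctbl (fun=> torG)).
Qed.

(** In the extension of Z/2 by Z/2 with middle term Z/4, both lifts of 1 have order four. *)
Lemma exists_nonsplit : exists (A B : proTorPAb R) (a : A) (E : ses B A),
  [/\ a *+ 2 = 0 & ~ order2_lift a E].
Proof.
have tors (n : nat) : torsion ('I_n.+1 : zmodType).
  by move=> x; exists n.+1 => //; apply: val_inj; rewrite Zp_mulrn /= modnMl.
have [F2 F2E] := discrete_filtration (countableP _) (tors 1%N).
have [F4 F4E] := discrete_filtration (countableP _) (tors 3).
pose A := filtered_object R F2; pose M := filtered_object R F4.
have ad2 : @adapted A (filtered_filtration R F2) := @filtered_adapted R _ F2.
have ad4 : @adapted M (filtered_filtration R F4) := @filtered_adapted R _ F4.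
(* Doubling and reduction modulo 2; their properties are checked on all elements. *)
pose i0 (x : 'I_2) : 'I_4 := inZp (x * 2); pose p0 (x : 'I_4) : 'I_2 := inZp x.
have i0B : {morph i0 : x y / x - y}.
  by move=> [[|[|x]] //= ?] [[|[|y]] //= ?]; exact: val_inj.
have p0B : {morph p0 : x y / x - y}.
  by move=> [[|[|[|[|x]]]] //= ?] [[|[|[|[|y]]]] //= ?]; exact: val_inj.
have i0_inj : injective i0.
  by move=> [[|[|x]] //= ?] [[|[|y]] //= ?] // /(congr1 val) //= _;
    exact: val_inj.
have p0i0 x : p0 (i0 x) = 0 by case: x => [[|[|x]] //= ?]; exact: val_inj.
have p0_ker x : p0 x = 0 -> exists y, i0 y = x.
  case: x => [[|[|[|[|x]]]] //= ?] /(congr1 val) //= _.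
    by exists 0; exact: val_inj.
  by exists 1; exact: val_inj.
have p0_surj y : exists x, p0 x = y.
  case: y => [[|[|y]] //= ?]; first by exists 0; exact: val_inj.
  by exists 1; exact: val_inj.
have p0_order4 x : p0 x = 1 -> x *+ 2 <> 0.
  by case: x => [[|[|[|[|x]]]] //= ?] /(congr1 val) //= _ /(congr1 val).
have [i iE] : exists i : hom A M, i =1 i0.
  apply: (exists_hom ad2 ad4) => [x y|n]; first exact: i0B.
  by exists 0%N => x /F2E ->; apply/F4E; exact: val_inj.
have [p pE] : exists p : hom M A, p =1 p0.
  apply: (exists_hom ad4 ad2) => [x y|n]; first exact: p0B.
  by exists 0%N => x /F4E ->; apply/F2E; exact: val_inj.
have ex : short_exact i p.
  apply: (short_exactI ad2 ad4).
  - by move=> x y; rewrite !iE => /i0_inj.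
  - apply/seteqP; split=> [_ [x _ <-]|x /=]; first by rewrite /= iE pE;
      exact: p0i0.
    by rewrite pE => /p0_ker[y <-]; exists y; rewrite ?iE.
  - by apply/seteqP; split=> // y _; have [x <-] := p0_surj y; exists x;
      rewrite ?pE.
  move=> n; exists 0%N => x /F4E; rewrite iE => ix; apply/F2E.
  by apply: i0_inj; rewrite ix; exact: val_inj.
exists A, A, (1 : 'I_2), (Ses ex); split; first exact: val_inj.
by move=> [x]; rewrite /= pE; exact: p0_order4.
Qed.

Lemma not_Ext_trivial_above0 : ~ Ext_trivial_above R 0.
Proof.
have [A [B [a [E [a2 nlift]]]]] := exists_nonsplit => triv.
have [M [i [p [ex univ]]]] := biproduct_exists B A.
apply: nlift; apply/(order2_lift_equiv a (triv 1%N isT A B E (Ses ex))).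
(* [h] is a section of [p], so [h a] is a lift of [a] killed by 2. *)
have [f _] := exists_zero_hom A B; have [h hE] := univ A f (id_hom A).
exists (h a); first by have [] := hE a.
by rewrite -raddfMn a2 raddf0.
Qed.

End Ext.

Theorem corollary4p11 (R : realType) :
  enough_injectives R /\ homological_dimension R 1.
Proof.
split=> [A|].
  have [I [C [i [p [injI _ [[iinj icl _] _ _]]]]]] := injective_resolution A.
  by exists I, i.
split; first exact: Ext_trivial_above1.
move=> [|d'] // /not_Ext_trivial_above0 [].
Qed.
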